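(* Let $q\ge1$, $N\ge1$, $m_0\in\mathbb{Z}$, and let $$\gamma_m=\sum_{j=1}^{q}c_j\zeta_j^m,\qquad \zeta_j=e^{-iz_j},\quad z_j\in\mathbb{C},$$ for $m=m_0,\ldots,m_0+N-1$, with exactly $q$ nonzero coefficients $c_1,\ldots,c_q\in\mathbb{C}\setminus\{0\}$ and pairwise distinct nodes $\zeta_1,\ldots,\zeta_q$. Put $\widetilde\gamma_r=\gamma_{m_0+r}$ and let $H=(\widetilde\gamma_{r+s})_{0\le r\le L-1,\,0\le s\le K-1}\in\mathbb{C}^{L\times K}$, where $L+K-1=N$. Assume $L\ge q+1$ and $K\ge q$. Let $U\in\mathbb{C}^{L\times q}$ have orthonormal columns spanning the dominant $q$-dimensional left singular subspace of $H$, let $U_0$ and $U_1$ be obtained from $U$ by deleting its last and its first row, respectively, and set $S=U_0^\dagger U_1$. Then $\operatorname{rank}H=q$, $U_0$ has full column rank, and $$S=T^{-1}\operatorname{diag}(\zeta_1,\ldots,\zeta_q)\,T$$ for some nonsingular $T\in\mathbb{C}^{q\times q}$. Hence the eigenvalues of $S$ are exactly $\zeta_1,\ldots,\zeta_q$ (ESPRIT recovers every $\zeta_j$ exactly), and the complex angles follow from $$z_j=i\operatorname{Log}\zeta_j\pmod{2\pi},$$ with a fixed branch $\operatorname{Log}$ of the logarithm.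
   Context: $A^\dagger$ denotes the Moore--Penrose pseudoinverse. The dominant $q$-dimensional left singular subspace of $H$ is the span of left singular vectors belonging to the $q$ largest singular values. *)

(* Defs.v *)
From HB Require Import structures.
From mathcomp Require Import all_boot all_order all_algebra.
From mathcomp Require Import complex.
From mathcomp Require Import all_classical all_reals all_analysis.

Set Implicit Arguments.
Unset Strict Implicit.
Unset Printing Implicit Defensive.

Import Order.TTheory GRing.Theory Num.Theory.
Local Open Scope ring_scope.
Local Open Scope complex_scope.
Local Open Scope sesquilinear_scope.

Definition expC (R : realType) (z : R[i]) : R[i] :=
  (expR (complex.Re z) * cos (complex.Im z))
    +i* (expR (complex.Re z) * sin (complex.Im z)).

(* Log may be any selection of logarithms of the nonzero complex numbers.  No
   continuity is required, so this covers the principal branch with any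
   convention on the cut, and any extension to the nonzero complex numbers of a
   continuous branch on a smaller domain. *)
Definition log_branch (R : realType) (Log : R[i] -> R[i]) : Prop :=
  forall w : R[i], w != 0 -> expC (Log w) = w.

Section Matrices.
Variable C : numClosedFieldType.

Definition hankel_mx (L K : nat) (g : nat -> C) : 'M[C]_(L, K) :=
  \matrix_(r < L, s < K) g (r + s)%N.

Definition drop_last_row (m n : nat) : 'M[C]_(m, n) -> 'M[C]_(m.-1, n) :=
  if m is m'.+1 then row' ord_max else id.

Definition drop_first_row (m n : nat) : 'M[C]_(m, n) -> 'M[C]_(m.-1, n) :=
  if m is m'.+1 then row' ord0 else id.

Definition penrose (m n : nat) (A : 'M[C]_(m, n)) (X : 'M[C]_(n, m)) : Prop :=
  [/\ A *m X *m A = A, X *m A *m X = X,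
      (A *m X) ^t* = A *m X & (X *m A) ^t* = X *m A].

(* The Moore-Penrose pseudoinverse; it differs from mxalgebra's pinvmx, which
   is only some generalized inverse.  The Penrose equations have exactly one
   solution, so the default value 0 of xget is never used as a default. *)
Definition mp_pinv (m n : nat) (A : 'M[C]_(m, n)) : 'M[C]_(n, m) :=
  xget 0 [set X | penrose A X]%classic.

End Matrices.

Section SVD.
Variable R : realType.

(* The singular values are s 0 >= s 1 >= ... >= s (minn m n).-1; the other
   values of s are irrelevant. *)
Definition is_svd (m n : nat) (A : 'M[R[i]]_(m, n))
    (W : 'M[R[i]]_m) (s : nat -> R) (V : 'M[R[i]]_n) : Prop :=
  [/\ W \is unitarymx, V \is unitarymx,
      forall i, (i < minn m n)%N -> 0 <= s i,
      forall i j, (i <= j < minn m n)%N -> s j <= s i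
    & A = W *m (\matrix_(i < m, j < n) (if i == j :> nat then (s i)%:C else 0))
            *m V ^t*].

(* The columns of U span the same subspace as the left singular vectors of some
   SVD of A belonging to its q largest singular values (mathcomp subspaces are
   row spaces, whence the transposes). *)
Definition spans_dominant_left (m n q : nat) (A : 'M[R[i]]_(m, n))
    (U : 'M[R[i]]_(m, q)) : Prop :=
  exists (W : 'M[R[i]]_m) (s : nat -> R) (V : 'M[R[i]]_n),
    is_svd A W s V /\
    (U^T == \sum_(i < m | (i < q)%N) <<(col i W)^T>>)%MS.

End SVD.

(* Main.v *)
Require Import Defs.
From mathcomp Require Import all_boot all_order all_algebra.
From mathcomp Require Import complex.
From mathcomp Require Import all_classical all_reals all_analysis.
From mathcomp Require Import zify lra.

Set Implicit Arguments.
Unset Strict Implicit.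
Unset Printing Implicit Defensive.

Import Order.TTheory GRing.Theory Num.Theory.
Local Open Scope ring_scope.
Local Open Scope complex_scope.
Local Open Scope sesquilinear_scope.

(** The nodes are read off from a shift invariance that survives a change of
    basis.  With [V_n] the [n * q] Vandermonde matrix of the nodes [zeta j] and
    [D] the diagonal matrix of the weights [c j * zeta j ^ m0], the Hankel
    matrix factors as [H = V_L D V_K^T] ([hankel_mx_exp_sum]).  The nodes are
    distinct, the weights nonzero and [q <= L, K], so all factors, and hence
    [H], have rank [q] ([exp_sum_factor_rank]), and [H] has the column space
    of [V_L].

    A matrix of rank [q] has at most [q] nonzero singular values, so its
    dominant [q]-dimensional left singular subspace is its column space
    ([dominant_left_colspace]).  Hence [U = V_L T] for an invertible [T].
    Deleting the last or the first row of [V_L] gives [V_(L-1)] and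
    [V_(L-1) diag(zeta)] respectively, so
    [[
      U0 = V_(L-1) T    and    U1 = V_(L-1) diag(zeta) T
                                  = U0 (T^-1 diag(zeta) T).
    ]]
    Since [q <= L - 1], [U0] has full column rank, its pseudoinverse is a left
    inverse ([mp_pinv_mulmx]), and [S = T^-1 diag(zeta) T].

    The angles are recovered because two complex numbers with the same
    exponential differ by a multiple of [2 pi i] ([expC_eq]). *)

(** * Hankel matrices of exponential sums *)

Lemma Vandermonde_rank (F : fieldType) (n q : nat) (x : 'rV[F]_q) :
  injective (x 0) -> (q <= n)%N -> \rank (Vandermonde n x) = q.
Proof.
move=> x_inj le_qn; apply/eqP; rewrite eqn_leq rank_leq_col /=.
have det_neq0 : \det (Vandermonde q x) != 0.
  rewrite det_Vandermonde; apply/prodf_neq0 => i _; apply/prodf_neq0 => j lt_ij.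
  by rewrite subr_eq0 (inj_eq x_inj) -val_eqE /= gtn_eqF.
rewrite -[leqLHS](@mxrank_unit F q (Vandermonde q x)); last first.
  by rewrite unitmxE unitfE.
have -> : Vandermonde q x = rowsub (widen_ord le_qn) (Vandermonde n x).
  by apply/matrixP => i j; rewrite !mxE.
exact: mxrankS (rowsub_sub _ _).
Qed.

(** Shifting the rows of a Vandermonde matrix by one multiplies column [j] by
    the node [x 0 j].  This rotational invariance is what ESPRIT exploits. *)
Lemma drop_first_row_Vandermonde (C : numClosedFieldType) (n q : nat)
    (x : 'rV[C]_q) :
  drop_first_row (Vandermonde n.+1 x) = Vandermonde n x *m diag_mx x.
Proof. by apply/matrixP => i j; rewrite mul_mx_diag !mxE lift0 exprSr. Qed.

Lemma drop_last_row_Vandermonde (C : numClosedFieldType) (n q : nat)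
    (x : 'rV[C]_q) :
  drop_last_row (Vandermonde n.+1 x) = Vandermonde n x.
Proof. by apply/matrixP => i j; rewrite !mxE lift_max. Qed.

Lemma drop_first_row_mulmx (C : numClosedFieldType) (m n p : nat)
    (A : 'M[C]_(m, n)) (B : 'M[C]_(n, p)) :
  drop_first_row (A *m B) = drop_first_row A *m B.
Proof. by case: m A => [|m] A //=; rewrite !row'Esub mul_rowsub_mx. Qed.

Lemma drop_last_row_mulmx (C : numClosedFieldType) (m n p : nat)
    (A : 'M[C]_(m, n)) (B : 'M[C]_(n, p)) :
  drop_last_row (A *m B) = drop_last_row A *m B.
Proof. by case: m A => [|m] A //=; rewrite !row'Esub mul_rowsub_mx. Qed.

(** Writing [x j ^ (r + s)] as [x j ^ r * x j ^ s] separates the row and the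
    column index of the Hankel matrix. *)
Lemma hankel_mx_exp_sum (C : numClosedFieldType) (L K q : nat) (a x : 'rV[C]_q)
    (g : nat -> C) :
  (forall k, (k < L + K - 1)%N -> g k = \sum_j a 0 j * x 0 j ^+ k) ->
  hankel_mx L K g = Vandermonde L x *m diag_mx a *m (Vandermonde K x)^T.
Proof.
move=> gE; apply/matrixP => r s; rewrite !mxE gE; last first.
  have := ltn_ord r; have := ltn_ord s; lia.
by apply: eq_bigr => j _; rewrite mul_mx_diag !mxE exprD mulrCA mulrA.
Qed.

Lemma diag_mx_unit (F : fieldType) (q : nat) (a : 'rV[F]_q) :
  (forall j, a 0 j != 0) -> diag_mx a \in unitmx.
Proof. by move=> a0; rewrite unitmxE unitfE det_diag; apply/prodf_neq0. Qed.

Lemma exp_sum_factor_rank (F : fieldType) (L K q : nat) (a x : 'rV[F]_q) :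
  (forall j, a 0 j != 0) -> injective (x 0) -> (q <= L)%N -> (q <= K)%N ->
  \rank (Vandermonde L x *m diag_mx a *m (Vandermonde K x)^T) = q.
Proof.
move=> a0 x_inj le_qL le_qK; rewrite mxrankMfree; last first.
  by rewrite /row_free mxrank_tr Vandermonde_rank.
by rewrite mxrankMfree ?Vandermonde_rank// row_free_unit diag_mx_unit.
Qed.

(** * The dominant left singular subspace of a matrix of rank q *)

(** If [s i] were nonzero for some [i >= q], so would be [s 0, ..., s i] by
    monotonicity; scaling the first [i.+1] rows by their inverses would give a
    partial identity matrix of rank [i.+1 > q]. *)
Lemma singular_value_eq0 (R : realType) (m n q : nat) (s : nat -> R) :
  (forall i, (i < minn m n)%N -> 0 <= s i) ->
  (forall i j, (i <= j < minn m n)%N -> s j <= s i) ->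
  \rank (\matrix_(i < m, j < n) (if i == j :> nat then (s i)%:C else 0)) = q ->
  forall i, (q <= i < minn m n)%N -> s i = 0.
Proof.
move=> s_ge0 s_mono rankq i /andP[le_qi lt_i]; apply/eqP/negP => /negP si0.
have s0 k : (k <= i)%N -> s k != 0.
  move=> le_ki; apply: lt0r_neq0; apply: lt_le_trans (s_mono k i _).
    by rewrite lt0r si0 s_ge0.
  by rewrite le_ki.
have [lt_im lt_in] : (i < m)%N /\ (i < n)%N by apply/andP; rewrite -leq_min.
set S := (\matrix_(_, _) _) in rankq.
pose d : 'rV[R[i]]_m := \row_k (if (k <= i)%N then ((s k)%:C)^-1 else 0).
have dS : diag_mx d *m S = pid_mx i.+1.
  apply/matrixP => k l; rewrite mul_diag_mx !mxE ltnS.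
  case: eqP => [_|_] /=; last by rewrite mulr0.
  case: leqP => [le_ki|_] /=; last by rewrite mul0r.
  by rewrite mulVf// fmorph_eq0 s0.
have : (i.+1 <= q)%N.
  by rewrite -rankq -(@rank_pid_mx R[i] m n i.+1)// -dS mxrankM_maxr.
by rewrite ltnNge le_qi.
Qed.

(** When [A] has rank [q], all its singular values of index at least [q]
    vanish, so the columns of [A] are combinations of its first [q] left
    singular vectors; equality follows since [U] has only [q] columns. *)
Lemma dominant_left_colspace (R : realType) (m n q : nat)
    (A : 'M[R[i]]_(m, n)) (U : 'M[R[i]]_(m, q)) :
  \rank A = q -> spans_dominant_left A U -> (U^T == A^T)%MS.
Proof.
move=> rankA [W [s [V [[Wu Vu s_ge0 s_mono AE] /andP[_ sumU]]]]].
rewrite andbC; set S := (\matrix_(_, _) _) in AE.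
have rankS : \rank S = q.
  rewrite -rankA AE mxrankMfree ?row_free_unit ?unitarymx_unit ?trmxC_unitary//.
  by rewrite -[RHS]mxrank_tr trmx_mul mxrankMfree ?mxrank_tr// row_free_unit
     unitmx_tr unitarymx_unit.
have sub : (A^T <= U^T)%MS.
  rewrite AE trmx_mul; apply: mulmx_sub.
  apply: submx_trans sumU; apply/row_subP => j.
  have [lt_jm|le_mj] := ltnP j m; last first.
    suff -> : row j (W *m S)^T = 0 by exact: sub0mx.
    apply/rowP => k; rewrite !mxE big1// => i _; rewrite !mxE.
    by rewrite ltn_eqF ?mulr0// (leq_trans (ltn_ord i)).
  have rowE : row j (W *m S)^T = (s j)%:C *: (col (Ordinal lt_jm) W)^T.
    apply/rowP => k; rewrite !mxE (bigD1 (Ordinal lt_jm))//= !mxE eqxx mulrC.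
    rewrite big1 ?addr0// => i neq_ij; rewrite !mxE.
    by rewrite -val_eqE /= in neq_ij; rewrite (negPf neq_ij) mulr0.
  rewrite rowE; have [lt_jq|le_qj] := ltnP j q.
    by apply/scalemx_sub/(sumsmx_sup (Ordinal lt_jm)) => //; rewrite genmxE.
  rewrite (singular_value_eq0 s_ge0 s_mono rankS) ?scale0r ?sub0mx//.
  by rewrite le_qj leq_min lt_jm ltn_ord.
rewrite sub /= -(geq_leqif (mxrank_leqif_sup sub)) mxrank_tr mxrank_tr rankA.
exact: rank_leq_col.
Qed.

(** * The Moore-Penrose inverse of a matrix of full column rank *)

(** If [v A^* A = 0] then [v A^*] has norm zero, and [A^*] has independent
    rows. *)
Lemma gram_unit (C : numClosedFieldType) (m n : nat) (A : 'M[C]_(m, n)) :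
  row_full A -> A ^t* *m A \in unitmx.
Proof.
move=> Afull; rewrite -row_free_unit; apply: inj_row_free => v vAA.
have At_free : row_free (A ^t*).
  by rewrite /row_free mxrank_map mxrank_tr; exact: Afull.
apply/eqP; rewrite -(mulmx_free_eq0 v At_free); apply/negP => /negP vA0.
have := dotmx_is_dotmx vA0.
rewrite dotmxE trmx_mul map_mxM /= trmxCK mulmxA -(mulmxA v) vAA mul0mx.
by rewrite mxE ltxx.
Qed.

(** The matrix [(A^* A)^-1 A^*] solves the Penrose equations, so [mp_pinv A] is
    a solution [X] too; then [A X A = A], and [A] can be cancelled on the
    left. *)
Lemma mp_pinv_mulmx (C : numClosedFieldType) (m n : nat) (A : 'M[C]_(m, n)) :
  row_full A -> mp_pinv A *m A = 1%:M.
Proof.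
move=> Afull; have Gu := gram_unit Afull.
set G := A ^t* *m A in Gu.
have GH : G ^t* = G by rewrite /G trmx_mul map_mxM /= trmxCK.
have [] : penrose A (mp_pinv A).
  apply: (@xgetI _ _ [set X | penrose A X]%classic (invmx G *m A ^t*)).
  have XA : invmx G *m A ^t* *m A = 1%:M by rewrite -mulmxA mulVmx.
  split.
  - by rewrite -mulmxA XA mulmx1.
  - by rewrite XA mul1mx.
  - by rewrite !trmx_mul !map_mxM /= trmxCK trmx_inv map_invmx /= GH mulmxA.
  - by rewrite XA trmx1 map_mx1.
move=> AXA _ _ _; apply: (row_full_inj Afull).
by rewrite mulmxA AXA mulmx1.
Qed.

(** * Similarity to a diagonal matrix and branches of the logarithm *)

Lemma eigenvalue_conj_diag (F : fieldType) (q : nat) (T : 'M[F]_q)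
    (d : 'rV[F]_q) (a : F) : T \in unitmx ->
  eigenvalue (invmx T *m diag_mx d *m T) a <-> exists j, a = d 0 j.
Proof.
move=> Tu; split=> [/eigenvalueP[v vS v0]|[j ->]].
  have wD : v *m invmx T *m diag_mx d = a *: (v *m invmx T).
    by rewrite scalemxAl -vS !mulmxA mulmxK.
  have w0 : v *m invmx T != 0.
    by rewrite mulmx_free_eq0 ?row_free_unit ?unitmx_inv.
  have [j wj0] : exists j, (v *m invmx T) 0 j != 0.
    apply/existsP; apply: contraNT w0; rewrite negb_exists => /forallP w0.
    by apply/eqP/rowP => j; have /negPn/eqP-> := w0 j; rewrite mxE.
  exists j; apply: (mulfI wj0); rewrite mulrC.
  by have /rowP/(_ j) := wD; rewrite mul_mx_diag !mxE => ->.
apply/eigenvalueP; exists (delta_mx 0 j *m T); last first.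
  rewrite mulmx_free_eq0 ?row_free_unit//; apply/eqP => /rowP/(_ j)/eqP.
  by rewrite !mxE !eqxx oner_eq0.
rewrite !mulmxA mulmxK// scalemxAl; congr (_ *m _).
apply/rowP => k; rewrite mul_mx_diag !mxE eqxx /=.
by case: eqP => [->|_]; rewrite ?mulr1 ?mul1r ?mulr0 ?mul0r.
Qed.

Lemma cosD2piz (R : realType) (x : R) (k : int) :
  cos (x + 2 * pi * k%:~R) = cos x.
Proof.
have nat_case (y : R) (n : nat) : cos (y + 2 * pi * n%:R) = cos y.
  by rewrite mulr_natr mulr_natl (periodicn (@cosD2pi R)).
case: k => n; first exact: nat_case.
by rewrite NegzE mulrNz mulrN -[LHS](nat_case _ n.+1) subrK.
Qed.

(** Subtracting from [x] its nearest multiple of [2 pi] reduces the claim to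
    [`|x| <= pi]; the cosine is even, and injective between [0] and [pi]. *)
Lemma cos_eq1 (R : realType) (x : R) :
  cos x = 1 -> exists k : int, x = 2 * pi * k%:~R.
Proof.
move=> cosx; have pi0 := pi_gt0 R.
pose k := Num.floor (x / (2 * pi) + 2^-1); exists k.
have xE : x = x / (2 * pi) * (2 * pi) by rewrite mulfVK// gt_eqF// mulr_gt0.
have /andP[lek ltk] := floor_itv (x / (2 * pi) + 2^-1).
rewrite -/k rmorphD /= in lek ltk.
pose y := x - 2 * pi * k%:~R.
have cosy : cos y = 1.
  by rewrite /y -[2 * _ * _]opprK -mulrN -mulrNz opprK cosD2piz.
have y_le : `|y| <= pi.
  rewrite ler_norml /y {1 2}xE; apply/andP; split; nra.
have : `|y| = 0.
  apply: cos_inj; rewrite ?in_itv /= ?lexx ?normr_ge0 ?pi_ge0//.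
  by rewrite cos0; case: ger0P => _; rewrite ?cosN.
by move/eqP; rewrite normr_eq0 subr_eq0 => /eqP.
Qed.

Lemma expC_neq0 (R : realType) (w : R[i]) : expC w != 0.
Proof.
apply/eqP => /eqP; rewrite eq_complex /= !mulf_eq0 !(gt_eqF (expR_gt0 _)) /=.
case/andP=> /eqP c0 /eqP s0.
by have := cos2Dsin2 (complex.Im w); rewrite c0 s0 expr0n addr0 => /eqP;
   rewrite eq_sym oner_eq0.
Qed.

(** Equal exponentials have equal moduli, hence equal real parts; the angles
    [b] and [b'] then have the same sine and cosine, so [cos (b - b') = 1]. *)
Lemma expC_eq (R : realType) (v w : R[i]) : expC v = expC w ->
  exists k : int, v = w + 'i%C * (2 * pi * k%:~R)%:C.
Proof.
case: v w => [a b] [a' b'] [/= eq_re eq_im].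
have eq_sq : expR a ^+ 2 = expR a' ^+ 2.
  rewrite -[LHS]mulr1 -[RHS]mulr1 -{1}(cos2Dsin2 b) -(cos2Dsin2 b').
  by rewrite !mulrDr -!exprMn eq_re eq_im.
have eq_exp : expR a = expR a'.
  by apply/eqP; rewrite -(@eqrXn2 _ 2) ?expR_ge0 ?eq_sq.
have eq_a := expR_inj eq_exp.
have ea0 : expR a' != 0 by rewrite gt_eqF ?expR_gt0.
rewrite eq_exp in eq_re eq_im.
have [k kE] : exists k : int, b - b' = 2 * pi * k%:~R.
  apply: cos_eq1; rewrite cosB (mulfI ea0 eq_re) (mulfI ea0 eq_im) -!expr2.
  exact: cos2Dsin2.
exists k; apply/eqP; rewrite eq_complex /= -kE eq_a.
by rewrite !mul0r mul1r subr0 addr0 add0r mul1r addrC subrK !eqxx.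
Qed.

Lemma log_branch_mod_2pi (R : realType) (Log : R[i] -> R[i]) (z : R[i]) :
  log_branch Log ->
  exists k : int,
    z = 'i%C * Log (expC (- ('i%C * z))) + (2 * pi * k%:~R)%:C.
Proof.
move=> logP; have [k ->] := expC_eq (logP _ (expC_neq0 (- ('i%C * z)))).
have ii (y : R[i]) : 'i%C * ('i%C * y) = - y.
  by rewrite mulrA -expr2 sqr_i mulN1r.
by exists k; rewrite mulrDr mulrN !ii opprK subrK.
Qed.

Theorem theorem5p1 (R : realType) (q N : nat) (m0 : int)
    (hq : (1 <= q)%N) (hN : (1 <= N)%N)
    (z c zeta : 'I_q -> R[i])
    (hzeta : forall j, zeta j = expC (- ('i%C * z j)))
    (zeta_inj : injective zeta)
    (hc : forall j, c j != 0)
    (gamma : int -> R[i])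
    (hgamma : forall m : int, m0 <= m <= m0 + N%:Z - 1 ->
       gamma m = \sum_(j < q) c j * zeta j ^ m)
    (L K : nat) (hLK : (L + K - 1 = N)%N)
    (hL : (q + 1 <= L)%N) (hK : (q <= K)%N)
    (H : 'M[R[i]]_(L, K))
    (hH : H = hankel_mx L K (fun r : nat => gamma (m0 + r%:Z)))
    (U : 'M[R[i]]_(L, q))
    (U_orthonormal : U ^t* *m U = 1%:M)
    (U_dominant : spans_dominant_left H U)
    (U0 U1 : 'M[R[i]]_(L.-1, q))
    (hU0 : U0 = drop_last_row U) (hU1 : U1 = drop_first_row U)
    (S : 'M[R[i]]_q) (hS : S = mp_pinv U0 *m U1) :
  [/\ \rank H = q,
      \rank U0 = q,
      exists2 T : 'M[R[i]]_q, T \in unitmx &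
        S = invmx T *m diag_mx (\row_(j < q) zeta j) *m T,
      forall a : R[i], eigenvalue S a <-> exists j : 'I_q, a = zeta j
    & forall Log : R[i] -> R[i], log_branch Log ->
        forall j : 'I_q, exists k : int,
          z j = 'i%C * Log (zeta j) + ((2 * pi) * k%:~R)%:C].
Proof.
destruct L as [|n]; first by rewrite addn1 in hL.
pose x : 'rV[R[i]]_q := \row_j zeta j.
pose a : 'rV[R[i]]_q := \row_j (c j * zeta j ^ m0).
have zeta0 j : zeta j != 0 by rewrite hzeta expC_neq0.
have x_inj : injective (x 0) by move=> i j; rewrite !mxE => /zeta_inj.
have a0 j : a 0 j != 0 by rewrite mxE mulf_neq0 ?expfz_neq0.
have HE : H = Vandermonde n.+1 x *m diag_mx a *m (Vandermonde K x)^T.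
  rewrite hH; apply: hankel_mx_exp_sum => k lt_k.
  rewrite hgamma; last by move: lt_k; rewrite hLK; lia.
  by apply: eq_bigr => j _; rewrite !mxE expfzDr// mulrA.
have le_qn : (q <= n)%N by rewrite -ltnS -addn1.
have le_qL := leqW le_qn.
have rankH : \rank H = q by rewrite HE exp_sum_factor_rank.
have /andP[UH HU] := dominant_left_colspace rankH U_dominant.
have [D UE] : exists D, U = Vandermonde n.+1 x *m D.
  have /submxP[D UD] : (U^T <= (Vandermonde n.+1 x)^T)%MS.
    apply: submx_trans UH _; rewrite HE -mulmxA trmx_mul.
    exact: submxMl.
  by exists D^T; rewrite -[U]trmxK UD trmx_mul trmxK.
have Du : D \in unitmx.
  rewrite -row_free_unit /row_free eqn_leq rank_leq_row -[leqLHS]rankH.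
  rewrite -mxrank_tr (leq_trans (mxrankS HU))// mxrank_tr UE.
  exact: mxrankM_maxr.
have U0E : U0 = Vandermonde n x *m D.
  by rewrite hU0 UE drop_last_row_mulmx drop_last_row_Vandermonde.
have U1E : U1 = U0 *m (invmx D *m diag_mx x *m D).
  rewrite hU1 UE drop_first_row_mulmx drop_first_row_Vandermonde U0E !mulmxA.
  by rewrite mulmxK.
have rankU0 : \rank U0 = q.
  by rewrite U0E mxrankMfree ?Vandermonde_rank ?row_free_unit.
have SE : S = invmx D *m diag_mx x *m D.
  rewrite hS U1E mulmxA mp_pinv_mulmx ?mul1mx//.
  by rewrite /row_full rankU0.
split=> //.
- by exists D.
- move=> b; rewrite SE; apply: iff_trans (eigenvalue_conj_diag _ _ Du) _.
  by split=> -[j ->]; exists j; rewrite mxE.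
- by move=> Log logP j; rewrite hzeta; exact: log_branch_mod_2pi.
Qed.
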